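(* Let $\mathcal A$ be an infinite almost disjoint family on a set $S$ with $\bigcup\mathcal A=S$, and let $K_{\mathcal A}$ be its Mrówka space. (1) $K_{\mathcal A^\star}=G(K_{\mathcal A})$, i.e. the bijection $K_{\mathcal A^\star}\to G(K_{\mathcal A})$ sending $F\in S^\star$ to the class of $F$, $A^\star$ to the class of $A\cup\{A\}$ (for $A\in\mathcal A$) and $\infty^\star$ to $\infty$ is a homeomorphism; and $G(K_{\mathcal A})$ is a Mrówka space with a continuous join semilattice operation, and $G(K_{\mathcal A})$ has a canonical clopen selector. (2) The map $\eta:K_{\mathcal A}\to K_{\mathcal A^\star}$ defined by $\eta(x)={\downarrow}x$ for $x\in K_{\mathcal A}$ (identifying $K_{\mathcal A^\star}$ with $G(K_{\mathcal A})$) is one-to-one, increasing and continuous.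
   Context: A family $\mathcal A$ of infinite subsets of a set $S$ is almost disjoint if $A\cap B$ is finite for distinct $A,B\in\mathcal A$. For infinite $\mathcal A$, the compact space $K_{\mathcal A}=S\cup\mathcal A\cup\{\infty\}$ has topology: points of $S$ are isolated; basic neighborhoods of $A\in\mathcal A$ are $\{A\}\cup(A\setminus F)$, $F\subseteq A$ finite; basic neighborhoods of $\infty$ are $K_{\mathcal A}\setminus\bigcup_{A\in\mathcal S}(\{A\}\cup A)$, $\mathcal S\subseteq\mathcal A$ finite (and complements of finite sets of points of $S$ are also allowed, so that the space is Hausdorff). A Mrówka space is a compact scattered unitary space of Cantor–Bendixson height 2 (second derivative a singleton), i.e. a space of the form $K_{\mathcal A}$. $K_{\mathcal A}$ is ordered by its canonical clopen selector $U_s=\{s\}$ ($s\in S$), $U_A=A\cup\{A\}$ ($A\in\mathcal A$), $U_\infty=K_{\mathcal A}$, with $x\le y$ iff $U_x\subseteq U_y$; ${\downarrow}x=U_x$. $[S]^{<\omega}_*$ denotes the set of nonempty finite subsets of $S$. Put $S^\star=[S]^{<\omega}_*$, $A^\star=[A]^{<\omega}_*$ and $\mathcal A^\star=\{A^\star:A\in\mathcal A\}$, an almost disjoint family on $S^\star$; $K_{\mathcal A^\star}=S^\star\cup\mathcal A^\star\cup\{\infty^\star\}$ is the corresponding space. $H(K_{\mathcal A})$ is the set of nonempty closed initial (downward closed) subsets of $K_{\mathcal A}$, ordered by inclusion, with join given by union and with the topology generated by $U^+=\{K:K\subseteq U\}$ and $V^-=\{K:K\cap V\ne\emptyset\}$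 for $U$ clopen initial and $V$ clopen final. Let $E\subseteq H(K_{\mathcal A})$ be the set consisting of all members other than the nonempty finite subsets of $S$ and the sets $A\cup\{A\}$, $A\in\mathcal A$. $E$ is a closed final subset, and $G(K_{\mathcal A})$ is the quotient space of $H(K_{\mathcal A})$ obtained by collapsing $E$ to one point $\infty$. It is ordered by $L\le L'$ iff $L\subseteq L'$ or $L'=\infty$. A clopen selector for $X$ is a family $\{U_x : x\in X\}$ of clopen sets with: (1) $x\in U_x$; (2) for distinct $x,y$, $x\notin U_y$ or $y\notin U_x$; (3) $y\in U_x$ implies $U_y\subseteq U_x$. It is canonical if for each $x$, the last nonempty Cantor–Bendixson derivative of $U_x$ is $\{x\}$. *)

(* Defs.v *)
From HB Require Import structures.
From mathcomp Require Import all_boot generic_quotient.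
From mathcomp Require Import mathcomp_extra boolp classical_sets functions.
From mathcomp Require Import cardinality filter topology.

Set Implicit Arguments.
Unset Strict Implicit.
Unset Printing Implicit Defensive.

Local Open Scope classical_set_scope.
Local Open Scope quotient_scope.

Section CantorBendixson.
Context {X : topologicalType}.

Definition cb_derived (U : set X) : set X := U `&` limit_point U.

(* The transfinite sequence of Cantor-Bendixson derivatives of [U] (as a
   subspace), presented without ordinals: these derivatives form a decreasing
   chain, well-ordered by reverse inclusion, and the one of limit index is the
   intersection of the preceding ones; so they are exactly the members of the
   least class containing [U] and closed under [cb_derived] and under nonempty
   intersections. *)
Inductive cb_derivative (U : set X) : set X -> Prop :=
| Cb0 : cb_derivative U U
| CbS D of cb_derivative U D : cb_derivative U (cb_derived D)
| CbLim (C : set (set X)) of C !=set0 & (forall D, C D -> cb_derivative U D) :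
    cb_derivative U (\bigcap_(D in C) D).

(* "last" means smallest, the derivatives being decreasing *)
Definition last_cb_derivative (U D : set X) : Prop :=
  [/\ cb_derivative U D, D !=set0 &
      forall D', cb_derivative U D' -> D' !=set0 -> D `<=` D'].

Definition clopen_selector (U : X -> set X) : Prop :=
  [/\ forall x, clopen (U x),
      forall x, U x x,
      forall x y, x <> y -> ~ U y x \/ ~ U x y &
      forall x y, U x y -> U y `<=` U x].

Definition canonical_clopen_selector (U : X -> set X) : Prop :=
  clopen_selector U /\ forall x, last_cb_derivative (U x) [set x].

End CantorBendixson.

Definition scattered (X : topologicalType) : Prop :=
  forall B : set X, B !=set0 -> isolated B !=set0.

Definition is_mrowka_space (X : topologicalType) : Prop :=
  [/\ compact [set: X], hausdorff_space X, scattered X &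
      exists p : X, cb_derived (cb_derived [set: X]) = [set p]].

Definition partial_order {T : Type} (le : T -> T -> Prop) : Prop :=
  [/\ forall x, le x x,
      forall x y, le x y -> le y x -> x = y &
      forall x y z, le x y -> le y z -> le x z].

Definition is_join {T : Type} (le : T -> T -> Prop) (j : T -> T -> T) : Prop :=
  forall x y z, le (j x y) z <-> le x z /\ le y z.

Section KSpace.
Context {S : Type}.

Definition almost_disjoint (A : set (set S)) : Prop :=
  (forall B, A B -> infinite_set B) /\
  (forall B C, A B -> A C -> B <> C -> finite_set (B `&` C)).

Variant kspace (A : set (set S)) : Type :=
| KPoint of S
| KLimit of A
| KInfty.

Context {A : set (set S)}.
Local Notation K := (kspace A).

Definition kpoint : S -> K := @KPoint A.
Definition klimit : A -> K := @KLimit A.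
Definition kinfty : K := @KInfty A.

Definition ksel (x : K) : set K :=
  match x with
  | KPoint s => [set kpoint s]
  | KLimit B => klimit B |` kpoint @` (val B)
  | KInfty => setT
  end.

Definition kle (x y : K) : Prop := ksel x `<=` ksel y.

Definition kbase (x : K) : set (set K) :=
  match x with
  | KPoint s => [set [set kpoint s]]
  | KLimit B => [set klimit B |` kpoint @` (val B `\` F) |
                   F in [set F : set S | finite_set F /\ F `<=` val B]]
  | KInfty => [set ~` (kpoint @` F `|` \bigcup_(B in C) ksel (klimit B)) |
                 F in @finite_set S & C in @finite_set A]
  end.

(* This is a topology for any family; almost disjointness makes the members of
   [kbase x] open (lemma [kbase_open]), hence a neighborhood base at [x]. *)
Definition kopen (U : set K) : Prop :=
  forall x, U x -> exists2 V, kbase x V & V `<=` U.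

Lemma kopenT : kopen setT.
Proof.
case=> [s|B|] _.
- by exists [set kpoint s].
- exists (klimit B |` kpoint @` (val B `\` set0)); last by [].
  by exists set0; first by split.
- exists (~` (kpoint @` set0 `|` \bigcup_(B in set0) ksel (klimit B))) => //=.
  by exists set0 => //; exists set0.
Qed.

Lemma kopenI : setI_closed kopen.
Proof.
move=> U V oU oV x [/oU[U' bU sU] /oV[V' bV sV]].
case: x bU bV => [s|B|].
- move=> /= eU eV; exists [set kpoint s] => // y ys.
  by split; [apply: sU; rewrite eU | apply: sV; rewrite eV].
- move=> [F [finF FB] FU] [G [finG GB] GV].
  exists (klimit B |` kpoint @` (val B `\` (F `|` G))).
    exists (F `|` G) => //; split; first by rewrite finite_setU.
    by rewrite subUset.
  move=> y yFG; split; [apply: sU; rewrite -FU | apply: sV; rewrite -GV];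
    case: yFG => [->|[s [Bs /not_orP[nFs nGs]] <-]]; try by left.
  - by right; exists s.
  - by right; exists s.
- move=> [F finF [C finC CU]] [G finG [D finD DV]].
  exists (~` (kpoint @` (F `|` G) `|` \bigcup_(B in C `|` D) ksel (klimit B))).
    exists (F `|` G) => /=; first by rewrite finite_setU.
    by exists (C `|` D) => //=; rewrite finite_setU.
  move=> y nFG; split; [apply: sU; rewrite -CU | apply: sV; rewrite -DV];
    move=> h; apply: nFG; case: h => [[s ? <-]|[B ? ?]].
  - by left; exists s => //; left.
  - by right; exists B => //; left.
  - by left; exists s => //; right.
  - by right; exists B => //; right.
Qed.

Lemma kopen_bigU (I : Type) (f : I -> set K) :
  (forall i, kopen (f i)) -> kopen (\bigcup_i f i).
Proof.
move=> of_ x [i _ /of_[V bV sV]]; exists V => // y /sV fy.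
by exists i.
Qed.

Lemma kbase_open (x : K) (V : set K) :
  almost_disjoint A -> kbase x V -> kopen V.
Proof.
move=> adA; case: x => [s ->|B [F [finF FB] <-]|[F finF [C finC <-]]].
- by move=> y /= ->; exists [set kpoint s].
- move=> y [->|[s Bs <-]].
    by exists (klimit B |` kpoint @` (val B `\` F)) => //; exists F.
  exists [set kpoint s] => // z /= ->; by right; exists s.
- move=> [s|D|] ny; last 1 first.
  + exists (~` (kpoint @` F `|` \bigcup_(B in C) ksel (klimit B))) => //.
    by exists F => //; exists C.
  + by exists [set kpoint s] => // z /= ->.
  pose G := (F `|` \bigcup_(B in C) (val B `&` val D)) `&` val D.
  exists (klimit D |` kpoint @` (val D `\` G)).
    exists G => //; split; last by move=> ? [].
    apply: finite_setIl; rewrite finite_setU; split => //.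
    apply: bigcup_finite => // B CB; apply: adA.2;
      [exact: set_mem (valP B)|exact: set_mem (valP D)|].
    move=> /val_inj BD; apply: ny; right; exists B => //.
    by left; rewrite BD.
  move=> y [->//|[s [Ds nGs] <-]] [[t Ft [ts]]|[B CB [//|[t Bt [ts]]]]].
    by apply: nGs; split => //; left; rewrite -ts.
  by apply: nGs; split => //; right; exists B => //; rewrite -ts; split => //;
    rewrite ts.
Qed.

End KSpace.

HB.instance Definition _ (S : Type) (A : set (set S)) := gen_eqMixin (kspace A).
HB.instance Definition _ (S : Type) (A : set (set S)) :=
  gen_choiceMixin (kspace A).
HB.instance Definition _ (S : Type) (A : set (set S)) :=
  @isOpenTopological.Build (kspace A) kopen kopenT kopenI kopen_bigU.

Lemma kopenE (S : Type) (A : set (set S)) : @open (kspace A) = kopen.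
Proof. by []. Qed.

Definition fin_subsets (S : Type) : set (set S) :=
  [set F | finite_set F /\ F !=set0].
Arguments fin_subsets : clear implicits.

Definition star_set (S : Type) (B : set S) : set (fin_subsets S) :=
  [set F | val F `<=` B].

Definition star (S : Type) (A : set (set S)) : set (set (fin_subsets S)) :=
  @star_set S @` A.

Definition star_mem (S : Type) (A : set (set S)) (B : A) : star A :=
  SigSub (mem_set (imageP (@star_set S) (set_mem (valP B)))).

Section Hyperspace.
Variables (X : topologicalType) (le : X -> X -> Prop).

Definition initial (L : set X) : Prop := forall x y, le x y -> L y -> L x.
Definition final (L : set X) : Prop := forall x y, le x y -> L x -> L y.

Definition closed_initial : set (set X) :=
  [set L | [/\ closed L, initial L & L !=set0]].

Definition hyper : Type := closed_initial.

Definition hset (L : hyper) : set X := val L.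

Definition hyper_plus (U : set X) : set hyper := [set L | hset L `<=` U].
Definition hyper_minus (V : set X) : set hyper := [set L | hset L `&` V !=set0].

Definition hyper_subbase : set (set hyper) :=
  [set hyper_plus U | U in [set U | clopen U /\ initial U]] `|`
  [set hyper_minus V | V in [set V | clopen V /\ final V]].

Definition Hyper (L : set X) (cL : closed L) (iL : initial L) (nL : L !=set0) :
  hyper := SigSub (mem_set (And3 cL iL nL : closed_initial L)).

Lemma hyper_closed (L : hyper) : closed (hset L).
Proof. by have [] := set_mem (valP L). Qed.

Lemma hyper_initial (L : hyper) : initial (hset L).
Proof. by have [] := set_mem (valP L). Qed.

Lemma hyper_neq0 (L : hyper) : hset L !=set0.
Proof. by have [] := set_mem (valP L). Qed.

Lemma hyperU_initial (L M : hyper) : initial (hset L `|` hset M).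
Proof. by move=> x y xy [?|?]; [left|right]; apply: hyper_initial xy _. Qed.

Lemma hyperU_neq0 (L M : hyper) : hset L `|` hset M !=set0.
Proof. by have [x Lx] := hyper_neq0 L; exists x; left. Qed.

Definition hyper_join (L M : hyper) : hyper :=
  Hyper (closedU (@hyper_closed L) (@hyper_closed M))
        (@hyperU_initial L M) (hyperU_neq0 L M).

End Hyperspace.
Arguments hyper : clear implicits.

HB.instance Definition _ (X : topologicalType) (le : X -> X -> Prop) :=
  Choice.on (hyper X le).
HB.instance Definition _ (X : topologicalType) (le : X -> X -> Prop) :=
  @isSubBaseTopological.Build (hyper X le) (set (hyper X le))
    (@hyper_subbase X le) id.

Section GSpace.
Context {S : Type} {A : set (set S)}.
Local Notation K := (kspace A).
Local Notation H := (hyper K kle).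

Lemma kpoint_in_ksel (x : K) : ksel x x.
Proof. by case: x => [s|B|] //=; left. Qed.

Lemma ksel_kle (x y : K) : ksel y x -> kle x y.
Proof.
case: y => [s|B|] //=.
  by move=> ->; exact: subset_refl.
move=> [->|[s Bs <-]]; first exact: subset_refl.
by move=> z /= ->; right; exists s.
Qed.

Lemma kpoints_closed (F : set S) : finite_set F -> closed (@kpoint S A @` F).
Proof.
move=> finF; rewrite -(setCK (kpoint @` F)); apply: open_closedC.
rewrite kopenE; case=> [s|B|] nx.
- by exists [set kpoint s] => // y /= ->.
- exists (klimit B |` kpoint @` (val B `\` (F `&` val B))).
    exists (F `&` val B) => //; split; last by move=> ? [].
    exact: finite_setIl.
  move=> y [->//|[s [Bs nFs] <-]] [t Ft [ts]].
  by apply: nFs; split => //; rewrite -ts.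
- exists (~` (kpoint @` F `|` \bigcup_(B in set0) ksel (klimit B))).
    by exists F => //; exists set0.
  by move=> y ny Fy; apply: ny; left.
Qed.

Lemma kpoints_initial (F : set S) : initial kle (@kpoint S A @` F).
Proof.
move=> x y xy [s Fs sy]; exists s => //.
by move: xy; rewrite -sy => /(_ x (kpoint_in_ksel x)) /= ->.
Qed.

Lemma ksel_initial (x : K) : initial kle (ksel x).
Proof. by move=> y z yz /ksel_kle; apply; apply/yz/kpoint_in_ksel. Qed.

Lemma ksel_neq0 (x : K) : ksel x !=set0.
Proof. by exists x; exact: kpoint_in_ksel. Qed.

Lemma ksel_closed (adA : almost_disjoint A) (x : K) : closed (ksel x).
Proof.
case: x => [s|B|] /=; last exact: closedT.
  by rewrite -(image_set1 kpoint s); apply: kpoints_closed; exact: finite_set1.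
rewrite -[X in closed X]setCK; apply: open_closedC.
rewrite kopenE => -[s|C|] nx.
- by exists [set kpoint s] => // y /= ->.
- exists (klimit C |` kpoint @` (val C `\` (val B `&` val C))).
    exists (val B `&` val C) => //; split; last by move=> ? [].
    apply: adA.2; [exact: set_mem (valP B)|exact: set_mem (valP C)|].
    by move=> /val_inj BC; apply: nx; left; rewrite BC.
  move=> y [->//|[s [Cs nBs] <-]] [//|[t Bt [ts]]].
  by apply: nBs; split => //; rewrite -ts.
- exists (~` (kpoint @` set0 `|` \bigcup_(C in [set B]) ksel (klimit C))).
    by exists set0 => //; exists [set B] => //; exact: finite_set1.
  by move=> y ny By; apply: ny; right; exists B.
Qed.

Lemma kpoints_neq0 (F : fin_subsets S) : @kpoint S A @` (val F) !=set0.
Proof. by have [_ [s Fs]] := set_mem (valP F); exists (kpoint s), s. Qed.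

Definition hfin (F : fin_subsets S) : H :=
  Hyper (@kpoints_closed (val F) (set_mem (valP F)).1) (@kpoints_initial (val F))
        (kpoints_neq0 F).

Definition hdown (adA : almost_disjoint A) (x : K) : H :=
  Hyper (@ksel_closed adA x) (@ksel_initial x) (ksel_neq0 x).

Definition hfull : H :=
  Hyper closedT (@ksel_initial kinfty) (ksel_neq0 kinfty).

Definition hE : set H :=
  [set L | ~ (exists F : fin_subsets S, hset L = kpoint @` (val F)) /\
           ~ (exists B : A, hset L = ksel (klimit B))].

Definition collapse (L M : H) : bool := `[< L = M \/ hE L /\ hE M >].

Lemma collapse_refl : reflexive collapse.
Proof. by move=> L; apply/asboolP; left. Qed.

Lemma collapse_sym : symmetric collapse.
Proof.
by move=> L M; apply/asboolP/asboolP => -[->|[]]; by [left|right].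
Qed.

Lemma collapse_trans : transitive collapse.
Proof.
move=> M L N /asboolP[->|[EL EM]] /asboolP[MN|[EM' EN]]; apply/asboolP.
- by left.
- by right.
- by right; rewrite -MN.
- by right.
Qed.

Canonical collapse_equiv :=
  EquivRel collapse collapse_refl collapse_sym collapse_trans.

End GSpace.

Definition gspace (S : Type) (A : set (set S)) : Type :=
  quotient_topology {eq_quot @collapse S A}.

HB.instance Definition _ (S : Type) (A : set (set S)) :=
  Topological.on (gspace A).
HB.instance Definition _ (S : Type) (A : set (set S)) :=
  Quotient.on (gspace A).

Section GSpaceOrder.
Context {S : Type} {A : set (set S)}.

Definition gclass (L : hyper (kspace A) kle) : gspace A := \pi_(gspace A) L.

(* the point to which [hE] is collapsed, as the whole space [K_A] is in [hE] *)
Definition ginfty : gspace A := gclass hfull.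

Definition gle (x y : gspace A) : Prop :=
  (exists L M, [/\ gclass L = x, gclass M = y & hset L `<=` hset M]) \/
  y = ginfty.

Lemma hfull_hE : hE (hfull : hyper (kspace A) kle).
Proof.
split=> -[F eF]; have : (setT : set (kspace A)) kinfty by [];
  rewrite -[setT]/(hset hfull) eF.
- by case.
- by case=> [|[]].
Qed.

Lemma gclass_eq L M :
  gclass L = gclass M <-> L = M \/ hE L /\ hE M.
Proof.
rewrite /gclass; split => [/eqmodP/asboolP //|h].
by apply/eqmodP/asboolP.
Qed.

End GSpaceOrder.

(* Main.v *)
Require Import Defs.
From mathcomp Require Import all_boot generic_quotient finmap.
From mathcomp Require Import boolp classical_sets functions cardinality filter topology.

(** Both spaces are compared through certain clopen sets of K_A: call a set
[W] of points of K_A small if it is a finite set of isolated points or a set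
[ksel (klimit B)], that is, A together with its limit point for some A in the
family. Small sets are clopen and initial, every nonempty closed initial subset
of a small set is a finite set of points or a set [ksel (klimit B)], and
the members of the hyperspace that lie in no small set are exactly those of
the collapsed set E ([small_nhE], [nhE_small]). Hence E is final and the class
of [L] lies in [gbelow W], the image in G of the subsets of [W], exactly when
[L] is contained in [W] ([gbelow_gclass]). As [hyper_plus W] is clopen in the
hyperspace, [gbelow W] is clopen in G ([clopen_gbelow]).

The natural map [gstar] from K_(A-star) to G is a bijection because it merely
names the classes. Every basic clopen set [ksel y] of K_(A-star) other than
the whole space is a finite Boolean combination of preimages of sets
[gbelow W]: for y = A-star take W to be [ksel] of A itself, and the point [F]
is isolated as the only subset of [F] contained in no [F `\ s] with [s] in
[F]. So a map [f] into K_(A-star) is continuous as soon as all preimages of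
[gbelow W] under [gstar \o f] are clopen ([continuous_kstar]). This criterion
proves three continuity claims at once:
- for the inverse of [gstar] the preimages are the sets [gbelow W];
- for the join, an upper bound [W] of a union is one of both parts, so the
  preimage is a product of two clopen sets ([gbelow_gjoin]);
- for [eta], the preimage is [W] itself because [W] is initial.

The inverse of [gstar] is thus a continuous bijection from G to the Hausdorff
space K_(A-star), and G is compact, so it is a homeomorphism. Compactness of G
comes from that of the hyperspace ([hyper_compact]): an ultrafilter on the
latter converges to the intersection of the clopen initial sets [U] for which
[hyper_plus U] is large.

What remains is topological, and is transported from K_(A-star): any space
K_A of an infinite almost disjoint family is compact, Hausdorff, scattered,
of height 2, and [ksel] is a canonical clopen selector for it. Here the main
tool is that every nonempty set of points has an element [x] such that
[ksel x] contains no other element of the set ([ksel_minimal]). *)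

Local Open Scope classical_set_scope.

Set Implicit Arguments.
Unset Strict Implicit.

(** * Cantor-Bendixson derivatives and homeomorphisms *)

Section CantorBendixsonRank.
Context {X : topologicalType}.
Implicit Types U D : set X.

Lemma cb_derivedS U : cb_derived U `<=` U.
Proof. by move=> x []. Qed.

Lemma cb_derivative_sub U D : cb_derivative U D -> D `<=` U.
Proof.
elim=> {D} // [D _ DU|C [D CD] _ DU]; first exact: subset_trans (@cb_derivedS D) DU.
by move=> x /(_ D CD); exact: DU.
Qed.

Lemma cb_derivative_cb_derived U D :
  cb_derivative (cb_derived U) D -> cb_derivative U D.
Proof.
elim=> {D} [|D _ UD|C C0 _ CU]; [exact: CbS (Cb0 _)|exact: CbS|exact: CbLim].
Qed.

(** Peeling off the first step instead of the last one, as [iterSr] does; this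
makes induction on a finite rank possible. *)
Lemma cb_derivative_inv U D :
  cb_derivative U D -> D = U \/ cb_derivative (cb_derived U) D.
Proof.
elim=> {D} [|D _ [->|UD]|C [D0 CD0] _ IH]; first by left.
- by right; exact: Cb0.
- by right; exact: CbS.
(* An intersection of derivatives is [U] if all of them are, and otherwise it
   does not change when the copies of [U] are left out. *)
have [allU|/existsNP[D1 /not_implyP[CD1 nD1]]] := pselect (forall D, C D -> D = U).
  left; apply/seteqP; split=> [x /(_ D0 CD0)|x Ux D CD]; first by rewrite (allU D0).
  by rewrite (allU D).
have UD1 : cb_derivative (cb_derived U) D1 by have [] := IH D1 CD1.
right; rewrite (_ : bigcap C _ =
    \bigcap_(D in C `&` cb_derivative (cb_derived U)) D).
  by apply: CbLim => [|D []//]; exists D1.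
apply/seteqP; split=> [x Cx D [CD _]|x Cx D CD]; first exact: Cx.
have [->|UD] := IH D CD; last exact: Cx.
by have /(cb_derivative_sub UD1)/cb_derivedS := Cx D1 (conj CD1 UD1).
Qed.

(** For a space of finite rank the transfinite definition of the last
derivative can be replaced by iteration. *)
Lemma last_cb_derivative_iter n U x :
  iter n cb_derived U = [set x] -> last_cb_derivative U [set x].
Proof.
elim: n U => [U /= ->|n IHn U].
  split; [exact: Cb0|by exists x|move=> D /cb_derivative_sub + [y Dy] _ ->].
  by move=> /(_ y Dy) /= <-.
rewrite iterSr => /IHn[Ux x0 lx]; split=> //; first exact: cb_derivative_cb_derived.
move=> D /cb_derivative_inv[-> _|]; last exact: lx.
exact: subset_trans (cb_derivative_sub Ux) (@cb_derivedS U).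
Qed.

End CantorBendixsonRank.

Section Homeomorphism.
Context {X Y : topologicalType} {f : X -> Y} {g : Y -> X}.
Hypotheses (fK : cancel f g) (gK : cancel g f).
Hypotheses (cf : continuous f) (cg : continuous g).

Lemma cb_derived_homeo (D : set Y) :
  cb_derived (f @^-1` D) = f @^-1` cb_derived D.
Proof.
apply/seteqP; split=> x [Dx lx]; split=> // U.
  move=> /cf/lx[y [yx Dy Uy]]; exists (f y); split=> //.
  by apply: contra_neq yx; exact: can_inj.
move=> Ux; have /lx[y [yx Dy Uy]] : nbhs (f x) (g @^-1` U).
  by apply: cg; rewrite fK.
exists (g y); split; rewrite /= ?gK //.
by apply: contra_neq yx => <-; rewrite gK.
Qed.

Lemma iter_cb_derived_homeo n (D : set Y) :
  iter n cb_derived (f @^-1` D) = f @^-1` iter n cb_derived D.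
Proof. by elim: n => //= n ->; exact: cb_derived_homeo. Qed.

Lemma preimage_set1_can (y : Y) : f @^-1` [set y] = [set g y].
Proof. by apply/seteqP; split=> x /=; [move<-; rewrite fK|move=> ->; rewrite gK]. Qed.

Lemma mrowka_homeo : is_mrowka_space Y -> is_mrowka_space X.
Proof.
move=> [cY hY sY [p Yp]]; split.
- have -> : [set: X] = g @` [set: Y].
    by apply/seteqP; split=> // x _; exists (f x).
  by apply: continuous_compact cY; exact: continuous_subspaceT.
- move=> x y xy; rewrite -(fK x) -(fK y); congr g; apply: hY => U V Ux Vy.
  by have [z [Uz Vz]] := xy _ _ (cf Ux) (cf Vy); exists (f z).
- move=> B [x Bx].
  have [|y [/set_mem By [V Vy VB]]] := sY (g @^-1` B); first by exists (f x); rewrite /= fK.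
  exists (g y); split; first exact: mem_set.
  exists (f @^-1` V); first by apply: cf; rewrite gK.
  apply/seteqP; split=> [z [Vz Bz]|z -> /=].
    have : (V `&` g @^-1` B) (f z) by split; rewrite //= fK.
    by rewrite VB => /= <-; rewrite fK.
  by split=> //=; rewrite gK; exact: nbhs_singleton.
- exists (g p); rewrite -(preimage_setT f) !cb_derived_homeo Yp.
  exact: preimage_set1_can.
Qed.

Lemma clopen_selector_homeo (U : Y -> set Y) :
  clopen_selector U -> clopen_selector (fun x => f @^-1` U (f x)).
Proof.
move=> [cU Ux Uxy UU]; split=> [x|x|x y xy|x y xy z]; rewrite /preimage /=.
- exact: preimage_clopen.
- exact: Ux.
- by apply: Uxy => /(can_inj fK).
- exact: UU.
Qed.

End Homeomorphism.

Lemma continuous_inverse (X Y : topologicalType) (f : X -> Y) (g : Y -> X) :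
  compact [set: X] -> hausdorff_space Y -> continuous f ->
  cancel f g -> cancel g f -> continuous g.
Proof.
move=> cX hY cf fK gK; apply/continuous_closedP => C cC.
have -> : g @^-1` C = f @` C.
  by apply/seteqP; split=> [y Cy|_ [x Cx <-]]; [exists (g y)|rewrite /preimage /= fK].
apply: compact_closed hY _; apply: continuous_compact.
  exact: continuous_subspaceT.
exact: subclosed_compact cC cX _.
Qed.

Lemma clopen_bigcup (X : topologicalType) (I : Type) (D : set I) (F : I -> set X) :
  finite_set D -> (forall i, D i -> clopen (F i)) -> clopen (\bigcup_(i in D) F i).
Proof.
elim/Pchoice: I => I in D F *; move=> finD cF; split.
  by apply: bigcup_open => i /cF[].
by apply: closed_bigcup => // i /cF[].
Qed.

(** * The spaces K_A *)

Section KspaceTopology.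
Context {S : Type} {A : set (set S)}.
Hypothesis adA : almost_disjoint A.
Local Notation K := (kspace A).

Lemma kle_anti (x y : K) : ksel x y -> ksel y x -> x = y.
Proof.
case: x y => [s|B|] [t|C|] //=.
- by case=> [->//|[]].
- by move=> [//|[]].
- by move=> _ [//|[]].
Qed.

Lemma clopen_ksel (x : K) : clopen (ksel x).
Proof.
split; last exact: ksel_closed.
case: x => [s|B|]; last exact: openT.
- exact: (kbase_open (x := kpoint s)).
- by apply: (kbase_open (x := klimit B) adA); exists set0; [split|rewrite setD0].
Qed.

(** The defining neighborhood bases are of different shapes for the three
kinds of points; what all of them share is that they are of the form
[ksel x] minus finitely many smaller [ksel y]. Compactness and continuity
arguments only use this uniform description. *)
Lemma ksel_nbhs (U : set K) (x : K) : open U -> U x ->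
  exists Y : set K, [/\ finite_set Y,
    forall y, Y y -> ksel x y /\ ~ ksel y x &
    ksel x `\` \bigcup_(y in Y) ksel y `<=` U].
Proof.
rewrite kopenE => oU /oU[V + VU]; case: x => [s|B|] /=.
- move=> eV; exists set0; split=> // y [ys _]; apply: VU.
  by rewrite eV.
- move=> [F [finF FB] eV]; exists (kpoint @` F); split.
  + exact: finite_image.
  + by move=> y [s Fs <-]; split; [right; exists s => //; exact: FB|].
  + move=> y [ky nFy]; apply: VU; rewrite -eV.
    case: ky => [->|[s Bs sy]]; [by left|right; exists s => //; split=> // Fs].
    by apply: nFy; exists (kpoint s) => //; exists s.
- move=> [F finF [C finC eV]]; exists (kpoint @` F `|` klimit @` C); split.
  + by rewrite finite_setU; split; exact: finite_image.
  + by move=> _ [] [z _ <-]; split=> // -[//|[]].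
  + move=> y [_ ny]; apply: VU; rewrite -eV => -[[s Fs sy]|[B CB By]].
      by apply: ny; exists (kpoint s); [left; exists s|rewrite -sy].
    by apply: ny; exists (klimit B) => //; right; exists B.
Qed.

(** The order has height 3: try the isolated points, then the limits, and only
then the point at infinity. *)
Lemma ksel_minimal (P : set K) : P !=set0 ->
  exists2 x, P x & forall y, P y -> ksel x y -> y = x.
Proof.
move=> [x0 Px0].
have [[s Ps]|ns] := pselect (exists s, P (kpoint s)); first by exists (kpoint s).
have [[B PB]|nB] := pselect (exists B, P (klimit B)).
  exists (klimit B) => // y Py [//|[s _ sy]].
  by case: ns; exists s; rewrite sy.
by exists x0 => // y Py _; case: x0 y Px0 Py => [s|B|] [t|C|] // *;
  solve [case: ns; eexists; eassumption | case: nB; eexists; eassumption].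
Qed.

(** By antisymmetry, of two distinct points one is outside the [ksel] of the
other, and that clopen set separates them. *)
Lemma kspace_hausdorff : hausdorff_space K.
Proof.
have sep (x y : K) : ~ ksel y x -> exists2 AB : set K * set K,
    x \in AB.1 /\ y \in AB.2 & [/\ open AB.1, open AB.2 & AB.1 `&` AB.2 == set0].
  move=> nxy; have [oy cy] := clopen_ksel y.
  exists (~` ksel y, ksel y).
    by split; apply/mem_set => //=; exact: kpoint_in_ksel.
  by split => //=; [exact: closed_openC|rewrite setICl].
rewrite open_hausdorff => x y /eqP xy.
have [yx|/sep//] := pselect (ksel y x).
have [xy'|/sep[[U V]/= [yU xV] [oU oV UV]]] := pselect (ksel x y).
  by case: xy; exact: kle_anti.
by exists (V, U) => //=; split=> //; rewrite setIC.
Qed.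

(** An ultrafilter converges to the minimal point [x] for which [ksel x] is
large, since the smaller [ksel y] are not large. *)
Lemma kspace_compact : compact [set: K].
Proof.
rewrite compact_ultra => F uF _.
have [x Fx xmin] : exists2 x, F (ksel x) &
    forall y, F (ksel y) -> ksel x y -> y = x.
  by apply: (@ksel_minimal [set x | F (ksel x)]); exists kinfty; exact: filterT.
exists x; split=> // U; rewrite nbhsE => -[V [oV Vx] VU].
have [Y [finY Yx YV]] := ksel_nbhs oV Vx.
apply: filterS VU _; apply: filterS YV _; rewrite setDE setC_bigcup.
apply: filterI => //.
have /finite_fsetP[Z eZ] := finY; rewrite eZ; apply: filter_bigI => y yZ.
have [xy yx] := Yx y ltac:(by rewrite eZ).
have [Fy|//] := in_ultra_setVsetC (ksel y) uF.
by case: yx; rewrite (xmin y) //; exact: kpoint_in_ksel.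
Qed.

Lemma kspace_scattered : scattered K.
Proof.
move=> B /ksel_minimal[x Bx xmin]; exists x; split; first by rewrite inE.
exists (ksel x).
  by apply: open_nbhs_nbhs; split; [exact: (clopen_ksel x).1|exact: kpoint_in_ksel].
apply/seteqP; split=> y; first by case=> xy By; exact: xmin.
by move=> ->; split=> //; exact: kpoint_in_ksel.
Qed.

Lemma continuous_kspace (X : topologicalType) (f : X -> K) :
  (forall y, clopen (f @^-1` ksel y)) -> continuous f.
Proof.
move=> cf x U; rewrite nbhsE => -[V [oV Vx] VU].
have [Y [finY Yx YV]] := ksel_nbhs oV Vx.
suff : nbhs x ((f @^-1` ksel (f x)) `\` \bigcup_(y in Y) f @^-1` ksel y).
  by apply: filterS => z [fz nz]; apply: VU; apply: YV; split.
apply: open_nbhs_nbhs; split; last first.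
  by split; [exact: kpoint_in_ksel|move=> [y /Yx[_ ]]].
rewrite setDE; apply: openI; first exact: (cf _).1.
apply: closed_openC.
by apply: closed_bigcup => // y _; exact: (cf y).2.
Qed.

Lemma limit_point_kpoint (E : set K) (s : S) : ~ limit_point E (kpoint s).
Proof.
move=> /(_ (ksel (kpoint s))) [|y [ys _ /= yE]].
  by apply: open_nbhs_nbhs; split=> //; exact: (clopen_ksel (kpoint s)).1.
by rewrite yE eqxx in ys.
Qed.

(** This covers both limit points A and the point at infinity: in both cases
the part of [E] strictly below [x] is an infinite antichain, so removing finitely many
[ksel y] from [ksel x] removes finitely many of its elements. *)
Lemma limit_point_ksel (E : set K) (x : K) :
  infinite_set (E `&` (ksel x `\ x)) -> 
  (forall y z, y <> x -> ksel x y -> E z -> ksel y z -> z = y) ->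
  limit_point E x.
Proof.
move=> infE Ey U; rewrite nbhsE => -[V [oV Vx] VU].
have [Y [finY Yx YV]] := ksel_nbhs oV Vx.
have [y [[Ey' [xy yx]] nYy]] := infinite_setN0 (infinite_setD infE finY).
exists y; split=> //; first exact/eqP.
apply/VU/YV; split => // -[z Yz zy].
have [xz zx] := Yx z Yz.
have zE : y = z.
  apply: Ey xz Ey' zy => zx'; apply: zx; rewrite zx'.
  exact: kpoint_in_ksel.
by apply: nYy; rewrite zE.
Qed.

Lemma limit_pointS (E E' : set K) : E `<=` E' -> limit_point E `<=` limit_point E'.
Proof. by move=> EE x Ex U /Ex[y [yx /EE Ey Uy]]; exists y. Qed.

Lemma cb_derived_klimit (B : A) :
  cb_derived (ksel (klimit B)) = [set (klimit B : K)].
Proof.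
apply/seteqP; split=> [x [[//|[s _ <-]]]|x ->].
  by move/limit_point_kpoint.
split; first by left.
apply: limit_point_ksel => [|y z yB [//|[s _ <-]] _ //].
apply: (@sub_infinite_set _ (kpoint @` val B)).
  by move=> _ [s Bs <-]; split; [|split=> //]; right; exists s.
rewrite (eq_finite_set (inj_card_eq _)); first exact: adA.1 (set_mem (valP B)).
by move=> s t _ _ [].
Qed.

Hypothesis infA : infinite_set A.

Lemma cb_derived_kpointsC : cb_derived (~` range (@kpoint S A)) = [set kinfty].
Proof.
apply/seteqP; split=> [[s [_ /limit_point_kpoint]//|B [_]|//]|x ->].
  move=> /(_ (ksel (klimit B))) [|y [yB ny]].
    apply: open_nbhs_nbhs; split; first exact: (clopen_ksel _).1.
    exact: kpoint_in_ksel.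
  by case=> [yE|[s _ sy]]; [rewrite yE eqxx in yB|case: ny; exists s].
split; first by case.
apply: limit_point_ksel; last first.
  move=> y z yi _ nz; case: y yi => [s|B|] //= _ [//|[s _ sz]].
  by case: nz; exists s.
apply: (@sub_infinite_set _ (range (@klimit S A))).
  by move=> _ [B _ <-]; split => //; case.
rewrite (eq_finite_set (inj_card_eq _)); last by move=> B C _ _ [].
move=> finT; apply: infA.
apply: (sub_finite_set _ (finite_image val finT)) => B AB.
by exists (SigSub (mem_set AB)).
Qed.

Lemma cb_derived_kspace : cb_derived [set: K] = ~` range kpoint.
Proof.
apply/seteqP; split=> [x [_ lx] [s _ sx]|x nx].
  by rewrite -sx in lx; exact: limit_point_kpoint lx.
split=> //; case: x nx => [s nx|B _|_].
- by case: nx; exists s.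
- have [_ lB] : cb_derived (ksel (klimit B)) (klimit B).
    by rewrite cb_derived_klimit.
  exact: limit_pointS lB.
- have [_ li] : cb_derived (~` range kpoint) (@kinfty S A).
    by rewrite cb_derived_kpointsC.
  exact: limit_pointS li.
Qed.

Lemma kspace_mrowka : is_mrowka_space K.
Proof.
split; [exact: kspace_compact|exact: kspace_hausdorff|exact: kspace_scattered|].
by exists kinfty; rewrite cb_derived_kspace cb_derived_kpointsC.
Qed.

(** The rank of [x] is 0, 1 or 2 according to the kind of point. *)
Lemma iter_cb_derived_ksel (x : K) :
  exists n, iter n cb_derived (ksel x) = [set x].
Proof.
case: x => [s|B|]; first by exists 0.
- by exists 1; exact: cb_derived_klimit.
- by exists 2; rewrite /= cb_derived_kspace cb_derived_kpointsC.
Qed.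

Lemma clopen_selector_ksel : clopen_selector (@ksel S A).
Proof.
split; [exact: clopen_ksel|exact: kpoint_in_ksel| |by move=> x y /ksel_kle].
move=> x y xy; apply/not_andP => -[yx xy']; apply: xy; exact: kle_anti.
Qed.

End KspaceTopology.

(** * Compactness of the hyperspace *)

Section HyperspaceCompactness.
Context {X : topologicalType} {le : X -> X -> Prop}.
Local Notation H := (hyper X le).

Lemma hyper_inj : injective (@hset X le).
Proof. exact: val_inj. Qed.

Lemma hyper_openE : @open H = [set \bigcup_(i in D) i
  | D in [set D | D `<=` finI_from (@hyper_subbase X le) id]].
Proof. by []. Qed.

Lemma hyper_subbase_open : @hyper_subbase X le `<=` open.
Proof.
move=> W hW; rewrite hyper_openE; exists [set W]; last exact: bigcup_set1.
by move=> _ ->; exact: (finI_from1 id hW).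
Qed.

(** Convergence need only be tested on the given subbase. *)
Lemma hyper_cvg (F : set_system H) (L : H) : Filter F ->
  (forall W, @hyper_subbase X le W -> W L -> F W) -> F --> L.
Proof.
move=> FF FW W; rewrite nbhsE => -[V [+ VL] VW].
rewrite hyper_openE => -[D DH DV]; apply: (@filterS _ F FF _ _ VW).
move: VL; rewrite -DV => -[V' DV' V'L].
apply: (@filterS _ _ _ V'); first by move=> M; exists V'.
have [Z Zsub eZ] := DH _ DV'; rewrite -eZ; apply: filter_bigI => Y YZ.
apply: FW; first exact/set_mem/Zsub.
by move: V'L; rewrite -eZ; exact.
Qed.

Lemma final_setC (U : set X) : initial le U -> final le (~` U).
Proof. by move=> iU x y xy nUx /(iU _ _ xy). Qed.

Lemma initial_setC (U : set X) : final le U -> initial le (~` U).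
Proof. by move=> fU x y xy nUy /(fU _ _ xy). Qed.

(** The two kinds of subbasic sets are complements of each other, whence
[hyper_plus U] is clopen. *)
Lemma hyper_plusC (U : set X) :
  ~` @hyper_plus X le U = hyper_minus (~` U).
Proof.
apply/seteqP; split=> [L /existsNP[x /not_implyP[]]|L [x [Lx nUx]]]; first by exists x.
by move=> /(_ x Lx).
Qed.

Lemma clopen_hyper_plus (U : set X) :
  clopen U -> initial le U -> clopen (@hyper_plus X le U).
Proof.
move=> cU iU; split; first by apply: hyper_subbase_open; left; exists U.
rewrite -[X in closed X]setCK; apply: open_closedC.
apply: hyper_subbase_open; right; exists (~` U); last by rewrite hyper_plusC.
by split; [exact: clopenC|exact: final_setC].
Qed.

(** The limit of an ultrafilter is the intersection [L] of the clopen initial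
sets [U] with [hyper_plus U] large. These sets are closed under finite
intersections, so by compactness of [X] every open set containing [L] contains
one of them ([sepL]); this settles the subbasic sets [hyper_plus U] and, with
the open set [set0], shows that [L] is nonempty. The subbasic sets
[hyper_minus V] are handled by maximality of the ultrafilter. *)
Lemma hyper_compact : compact [set: X] -> compact [set: H].
Proof.
move=> cX; rewrite compact_ultra => F uF _.
pose B := [set U | [/\ clopen U, initial le U & F (hyper_plus U)]].
pose L := \bigcap_(U in B) U.
have BT : B setT.
  split; [exact: clopenT|by []|].
  by rewrite (_ : hyper_plus _ = setT); [exact: filterT|apply/seteqP; split].
have BI U V : B U -> B V -> B (U `&` V).
  move=> [cU iU FU] [cV iV FV]; split; first exact: clopenI.
  - by move=> x y xy [Uy Vy]; split; [exact: iU Uy|exact: iV Vy].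
  - apply: filterS2 FU FV => M MU MV x Mx; split; [exact: MU|exact: MV].
have sepL O : open O -> L `<=` O -> exists2 U, B U & U `<=` O.
  move=> oO LO; apply: contrapT => nO.
  pose G := filter_from B (fun U => U `\` O).
  have GF : ProperFilter G.
    apply: filter_from_proper; first apply: filter_from_filter.
    - by exists setT.
    - move=> U V BU BV; exists (U `&` V); first exact: BI.
      by move=> x [[Ux Vx] nOx].
    - move=> U BU; apply: contrapT => nU; apply: nO; exists U => // x Ux.
      by apply: contrapT => nOx; apply: nU; exists x.
  have [p [_ Gp]] := cX G GF (@filterT _ G _).
  have clp U : B U -> (U `\` O) p.
    move=> BU; have : closed (U `\` O).
      have [[_ cU] _ _] := BU.
      by rewrite setDE; apply: closedI => //; exact: open_closedC.
    by apply; move=> V /(Gp _ _); apply; exists U.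
  have [_ nOp] := clp _ BT; by apply: nOp; apply: LO => U /clp[].
have cL : closed L by apply: closed_bigI => U [[]].
have iL : initial le L.
  by move=> x y xy Ly U BU; have [_ iU _] := BU; apply: iU xy _; exact: Ly.
have L0 : L !=set0.
  apply: contrapT => nL; have [|U [_ _ FU] U0] := sepL set0 open0.
    by move=> y Ly; apply: nL; exists y.
  have [M MU] := filter_ex FU; have [x Mx] := hyper_neq0 M.
  exact: U0 (MU x Mx).
exists (Hyper cL iL L0); split=> //; apply: hyper_cvg.
move=> _ [[U [cU iU] <-] LU|[V [cV fV] <-] [x [Lx Vx]]].
- have [U' [_ _ FU'] U'U] := sepL U cU.1 LU.
  by apply: filterS FU' => M MU'; exact: subset_trans MU' U'U.
- have [//|] := in_ultra_setVsetC (hyper_minus V) uF.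
  rewrite -(setCK V) -hyper_plusC setCK => FV.
  have BV : B (~` V) by split; [exact: clopenC|exact: initial_setC|].
  by case: (Lx _ BV).
Qed.

End HyperspaceCompactness.

(** * The family of finite subsets *)

Section StarFamily.
Context {S : Type}.

Lemma finite_powerset (D : set S) : finite_set D -> finite_set [set E | E `<=` D].
Proof.
elim/Pchoice: S => T in D *.
move=> finD.
have : finite_set [set ([set` Z] : set T) | Z in [set` fpowerset (fset_set D)]].
  exact: finite_image.
apply: sub_finite_set.
  move=> E ED; exists (fset_set E); last exact/fset_setK/(sub_finite_set ED).
  rewrite /= fpowersetE -fset_set_sub //; exact: sub_finite_set finD.
Qed.

Definition FinSubset (F : set S) (finF : finite_set F) (F0 : F !=set0) :
  fin_subsets S := SigSub (mem_set (conj finF F0 : fin_subsets S F)).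

Definition fin_singleton (s : S) : fin_subsets S :=
  FinSubset (finite_set1 s) (ex_intro _ s erefl).

Lemma star_set_inj : injective (@star_set S).
Proof.
move=> B C BC; apply/seteqP; split=> s Bs.
- have : star_set C (fin_singleton s) by rewrite -BC => _ ->.
  exact.
- have : star_set B (fin_singleton s) by rewrite BC => _ ->.
  exact.
Qed.

Context {A : set (set S)}.

(** The singletons make [star_set B] infinite, and [star_set] commutes with
intersections, so that two members meet in the nonempty subsets of a finite
set. *)
Lemma almost_disjoint_star : almost_disjoint A -> almost_disjoint (star A).
Proof.
move=> [infA fin2]; split=> [_ [B AB <-]|_ _ [B AB <-] [C AC <-] BC].
  apply: (@sub_infinite_set _ (fin_singleton @` B)).
    by move=> _ [s Bs <-] _ ->.
  rewrite (eq_finite_set (inj_card_eq _)); first exact: infA.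
  by move=> s t _ _ [/seteqP[/(_ s erefl)]].
have /finite_powerset finBC : finite_set (B `&` C).
  by apply: fin2 => // BC'; apply: BC; rewrite BC'.
apply: (sub_finite_set _ (finite_preimage (f := val) _ finBC)).
  by move=> F [FB FC] s Fs; split; [exact: FB|exact: FC].
by move=> F G _ _; exact: val_inj.
Qed.

Lemma infinite_star : infinite_set A -> infinite_set (star A).
Proof.
by rewrite (eq_finite_set (inj_card_eq _)) // => B C _ _; exact: star_set_inj.
Qed.

Lemma star_mem_inj : injective (@star_mem S A).
Proof. by move=> B C [/star_set_inj/val_inj]. Qed.

Lemma star_mem_surj (C : star A) : exists B, star_mem B = C.
Proof.
have [B AB BC] := set_mem (valP C); exists (SigSub (mem_set AB)).
exact: val_inj.
Qed.

End StarFamily.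

(** * Small sets and the collapsed set *)

Section SmallSets.
Context {S : Type} {A : set (set S)}.
Hypothesis adA : almost_disjoint A.
Local Notation K := (kspace A).
Local Notation H := (hyper K kle).

(** Up to the empty set, the small sets are the members of the hyperspace
outside the collapsed set E. The empty set is included so that [small] is
closed under removing points from a finite set. *)
Definition small : set (set K) :=
  [set W | (exists2 F, finite_set F & W = kpoint @` F) \/
           exists B, W = ksel (klimit B)].

Lemma small_initial (W : set K) : small W -> initial kle W.
Proof. by case=> [[F _ ->]|[B ->]]; [exact: kpoints_initial|exact: ksel_initial]. Qed.

Lemma small_clopen (W : set K) : small W -> clopen W.
Proof.
case=> [[F finF ->]|[B ->]]; last exact: clopen_ksel.
split; last exact: kpoints_closed.
rewrite (_ : _ @` _ = \bigcup_(s in F) ksel (kpoint s)).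
  by apply: bigcup_open => s _; exact: (clopen_ksel adA _).1.
by apply/seteqP; split=> [_ [s Fs <-]|x [s Fs ->]]; exists s.
Qed.

Lemma sub_kpoints (L : set K) (F : set S) :
  L `<=` kpoint @` F -> L = kpoint @` [set s | L (kpoint s)].
Proof.
move=> LF; apply/seteqP; split=> [x Lx|_ [s Ls <-] //].
by have [s _ sx] := LF x Lx; exists s => //=; rewrite sx.
Qed.

(** A closed set that misses the limit of B misses a neighborhood of it, so
all but finitely many points of B. *)
Lemma sub_ksel_klimit (L : H) (B : A) :
  hset L `<=` ksel (klimit B) -> hset L = ksel (klimit B) \/
  exists2 F, finite_set F & hset L = kpoint @` F.
Proof.
move=> LB; have [LcB|nLB] := pselect (hset L (klimit B)).
  left; apply/seteqP; split=> // x /ksel_kle xB; exact: hyper_initial xB LcB.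
right; have LE : hset L `<=` kpoint @` val B.
  by move=> x Lx; case: (LB x Lx) => // xB; rewrite xB in Lx.
exists [set s | hset L (kpoint s)]; last exact: sub_kpoints LE.
have [Y [finY YB YL]] := ksel_nbhs (closed_openC (@hyper_closed _ _ L)) nLB.
apply: (sub_finite_set _ (finite_preimage (f := @kpoint S A) _ finY)); last first.
  by move=> s t _ _ [].
move=> s Ls; have [y Yy ys] : (\bigcup_(y in Y) ksel y) (kpoint s).
  apply: contrapT => nY; have := YL (kpoint s); apply; first by split=> //; exact: LB.
  exact: Ls.
have [[yB|[t _ ty]] nyB] := YB y Yy.
  by case: nyB; rewrite yB; left.
by rewrite -ty in ys; rewrite /preimage /= ys ty.
Qed.

Lemma small_nhE (W : set K) (L : H) : small W -> hset L `<=` W -> ~ hE L.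
Proof.
have finL (M : H) F : finite_set F -> hset M = kpoint @` F -> ~ hE M.
  move=> finF MF [nF _]; apply: nF.
  have F0 : F !=set0.
    by have [x] := hyper_neq0 M; rewrite -/(hset M) MF => -[s Fs _]; exists s.
  by exists (FinSubset finF F0).
case=> [[F finF ->] LF|[B ->] /sub_ksel_klimit[LB|[F finF LF]]].
- apply: finL (sub_kpoints LF); apply: sub_finite_set finF => s /LF[t Ft [<-//]].
- by move=> [_]; apply; exists B.
- exact: finL LF.
Qed.

Lemma nhE_small (L : H) : ~ hE L -> small (hset L).
Proof.
move=> /not_andP[/contrapT[F LF]|/contrapT[B LB]]; last by right; exists B.
by left; exists (val F) => //; exact: (set_mem (valP F)).1.
Qed.

Lemma hE_final (L M : H) : hset L `<=` hset M -> hE L -> hE M.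
Proof. by move=> LM EL; apply: contrapT => /nhE_small/small_nhE/(_ LM). Qed.

End SmallSets.

(** * The quotient G and its identification with K_(A-star) *)

Section GSpaceProperties.
Context {S : Type} {A : set (set S)}.
Hypothesis adA : almost_disjoint A.
Local Notation K := (kspace A).
Local Notation H := (hyper K kle).
Local Notation G := (gspace A).

Lemma gclass_surj (g : G) : exists L, gclass L = g.
Proof. by exists (repr g); exact: reprK. Qed.

Lemma gclass_infty (L : H) : gclass L = ginfty <-> hE L.
Proof.
rewrite gclass_eq; split=> [[->|[]//]|EL]; first exact: hfull_hE.
by right; split=> //; exact: hfull_hE.
Qed.

(** The order of G can be read off arbitrary representatives, because E is
final; the order and join axioms reduce to those of inclusion and union. *)
Lemma gle_gclass (L M : H) :
  gle (gclass L) (gclass M) <-> hset L `<=` hset M \/ hE M.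
Proof.
split=> [[[L' [M' [LL MM LM]]]|/gclass_infty]|[LM|/gclass_infty]]; last 3 first.
- by right.
- by left; exists L, M.
- by right.
move: MM LL => /gclass_eq[<-|[]]; last by right.
by move=> /gclass_eq[<-|[/(hE_final LM) EM _]]; [left|right].
Qed.

Lemma gle_partial_order : partial_order (@gle S A).
Proof.
split=> [g|g h|g h k].
- by have [L <-] := gclass_surj g; apply/gle_gclass; left.
- have [L <-] := gclass_surj g; have [M <-] := gclass_surj h.
  move=> /gle_gclass LM /gle_gclass ML; apply/gclass_eq.
  case: LM ML => [LM|EM] [ML|EL]; [|right..].
  + by left; apply: hyper_inj; apply/seteqP.
  + by split=> //; exact: hE_final LM EL.
  + by split=> //; exact: hE_final ML EM.
  + by [].
- have [L <-] := gclass_surj g; have [M <-] := gclass_surj h.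
  have [N <-] := gclass_surj k.
  move=> /gle_gclass LM /gle_gclass[MN|EN]; apply/gle_gclass; last by right.
  case: LM => [LM|EM]; [left; exact: subset_trans MN|right].
  exact: hE_final MN EM.
Qed.

Definition gjoin (g h : G) : G := gclass (hyper_join (repr g) (repr h)).

(** [gjoin] picks representatives; the choice is immaterial because a union
with a member of the final set E is in E. *)
Lemma gjoin_gclass (L M : H) :
  gjoin (gclass L) (gclass M) = gclass (hyper_join L M).
Proof.
have EU (L' M' : H) : hE L' \/ hE M' -> hE (hyper_join L' M').
  by case; apply: hE_final => x; [left|right].
rewrite /gjoin; apply/gclass_eq.
have /gclass_eq[->|[EL EL']] : gclass (repr (gclass L)) = gclass L by exact: reprK.
  have /gclass_eq[->|[EM EM']] : gclass (repr (gclass M)) = gclass M by exact: reprK.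
    by left.
  by right; split; apply: EU; right.
by right; split; apply: EU; left.
Qed.

Lemma gjoin_is_join : is_join (@gle S A) gjoin.
Proof.
move=> g h k; have [L <-] := gclass_surj g; have [M <-] := gclass_surj h.
have [N <-] := gclass_surj k.
rewrite gjoin_gclass !gle_gclass /hset /= subUset.
tauto.
Qed.

Lemma gspace_compact : compact [set: G].
Proof.
have -> : [set: G] = gclass @` [set: H].
  by apply/seteqP; split=> // g _; have [L <-] := gclass_surj g; exists L.
apply: continuous_compact; last exact: hyper_compact (@kspace_compact S A).
by apply: continuous_subspaceT; exact: pi_continuous.
Qed.

Definition gbelow (W : set K) : set G :=
  [set g | exists2 L, gclass L = g & hset L `<=` W].

Lemma gbelow_gclass (W : set K) (L : H) :
  small W -> gbelow W (gclass L) <-> hset L `<=` W.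
Proof.
move=> sW; split=> [[M /gclass_eq[->//|[EM _]] MW]|LW]; last by exists L.
by case: (small_nhE sW MW).
Qed.

Lemma clopen_gbelow (W : set K) : small W -> clopen (gbelow W).
Proof.
move=> sW; have [oW cW] := clopen_hyper_plus (small_clopen adA sW) (small_initial sW).
have pre : @gclass S A @^-1` gbelow W = hyper_plus W.
  by apply/seteqP; split=> L; rewrite /preimage /= -/(gclass L) gbelow_gclass.
split; first by rewrite /open /= /quotient_topology.quotient_open pre.
rewrite -[X in closed X]setCK; apply: open_closedC.
rewrite /open /= /quotient_topology.quotient_open -preimage_setC pre.
exact: closed_openC.
Qed.

Lemma gbelow_gjoin (W : set K) (g h : G) :
  small W -> gbelow W (gjoin g h) <-> gbelow W g /\ gbelow W h.
Proof.
move=> sW; have [L <-] := gclass_surj g; have [M <-] := gclass_surj h.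
by rewrite gjoin_gclass !gbelow_gclass // /hset /= subUset.
Qed.

Definition unstar (C : star A) : A := projT1 (cid (star_mem_surj C)).

Lemma unstarK : cancel unstar (@star_mem S A).
Proof. by move=> C; rewrite /unstar; case: cid. Qed.

Lemma star_memK : cancel (@star_mem S A) unstar.
Proof. by move=> B; apply: star_mem_inj; exact: unstarK. Qed.

(** The representative of each point of K_(A-star) in the hyperspace of K_A;
the whole space represents the collapsed set E. *)
Definition hstar (y : kspace (star A)) : H :=
  match y with
  | KPoint F => hfin F
  | KLimit C => hdown adA (klimit (unstar C))
  | KInfty => hfull
  end.

Definition gstar (y : kspace (star A)) : G := gclass (hstar y).

Lemma hdown_hE (x : K) : hE (hdown adA x) -> x = kinfty.
Proof.
case: x => [s|B|//] [nF nB]; last by case: nB; exists B.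
by case: nF; exists (fin_singleton s); rewrite /= image_set1.
Qed.

Lemma hstar_hE (y : kspace (star A)) : hE (hstar y) -> y = kinfty.
Proof.
case: y => [F|C|//] [nF nB]; first by case: nF; exists F.
by case: nB; exists (unstar C).
Qed.

Lemma hstar_inj : injective hstar.
Proof.
have kpoints_klimit (F : set S) (B : A) : kpoint @` F <> ksel (klimit B : K).
  by move=> FB; have [s _] : (kpoint @` F) (klimit B : K) by rewrite FB; left.
have kinf y : hset (hstar y) kinfty -> y = kinfty.
  by case: y => [F []|C [//|[]]|].
move=> y z yz; have {}yz : hset (hstar y) = hset (hstar z) by rewrite yz.
case: y z yz => [F|C|] [F'|C'|] yz.
- congr KPoint; apply/val_inj/seteqP; split=> s Fs.
    have : hset (hstar (KPoint _ F)) (kpoint s) by exists s.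
    by rewrite yz => -[t Ft [<-]].
  have : hset (hstar (KPoint _ F')) (kpoint s) by exists s.
  by rewrite -yz => -[t Ft [<-]].
- by case: (kpoints_klimit _ _ yz).
- by apply: kinf; rewrite yz.
- by case: (kpoints_klimit _ _ (esym yz)).
- have : hset (hstar (KLimit C)) (klimit (unstar C)) by left.
  rewrite yz => -[[CC]|[//]]; congr KLimit; exact: (can_inj unstarK).
- by apply: kinf; rewrite yz.
- by apply/esym/kinf; rewrite -yz.
- by apply/esym/kinf; rewrite -yz.
- by [].
Qed.

Lemma gstar_inj : injective gstar.
Proof.
move=> y z /gclass_eq[/hstar_inj//|[]].
by move=> /hstar_hE-> /hstar_hE->.
Qed.

Lemma gstar_surj (g : G) : exists y, gstar y = g.
Proof.
have [L <-] := gclass_surj g.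
have [EL|/not_andP[/contrapT[F LF]|/contrapT[B LB]]] := pselect (hE L).
- by exists kinfty; apply/gclass_eq; right; split=> //; exact: hfull_hE.
- by exists (kpoint F); rewrite /gstar; congr gclass; exact: hyper_inj.
- exists (klimit (star_mem B)); rewrite /gstar; congr gclass; apply: hyper_inj.
  by rewrite LB /= star_memK.
Qed.

Lemma gstar_bij :
  exists psi : G -> kspace (star A), cancel gstar psi /\ cancel psi gstar.
Proof.
exists (fun g => projT1 (cid (gstar_surj g))); split=> [y|g]; last by case: cid.
by apply: gstar_inj; case: cid.
Qed.

Lemma ksel_klimit_gbelow (C : star A) :
  ksel (klimit C) = gstar @^-1` gbelow (ksel (klimit (unstar C))).
Proof.
have sC : small (ksel (klimit (unstar C)) : set K) by right; exists (unstar C).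
apply/seteqP; split=> y; rewrite /preimage /= gbelow_gclass //.
  move=> [->|[F CF <-]] //= x [s Fs <-]; right; exists s => //.
  move: CF; rewrite -{1}(unstarK C) => CF; exact: CF.
case: y => [F|C'|] CF.
- right; exists F => //; rewrite -(unstarK C) => s Fs.
  by have [|[t Bt [<-]]] := CF (kpoint s) (ex_intro2 _ _ s Fs erefl).
- have [[CC]|[]//] := CF (klimit (unstar C')) (or_introl erefl).
  by left; congr KLimit; apply: (can_inj unstarK).
- by have [|[]] := CF kinfty I.
Qed.

(** Among the nonempty subsets of [F], only [F] itself is contained in no
[F `\ s] with [s] in [F]. *)
Lemma ksel_kpoint_gbelow (F : fin_subsets S) :
  ksel (kpoint F) = gstar @^-1` gbelow (kpoint @` val F) `\`
    \bigcup_(s in val F) gstar @^-1` gbelow (kpoint @` (val F `\ s)).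
Proof.
have finF : finite_set (val F) := (set_mem (valP F)).1.
have belowF D y : D `<=` val F ->
    gbelow (kpoint @` D) (gstar y) <-> hset (hstar y) `<=` kpoint @` D.
  by move=> DF; apply: gbelow_gclass; left; exists D => //; exact: sub_finite_set finF.
apply/seteqP; split=> [y ->|y [+ ny]].
  split; first by apply/belowF.
  move=> [s Fs /(belowF _ _ (@subDsetl _ _ _))].
  by move=> /(_ (kpoint s) (ex_intro2 _ _ s Fs erefl))[t [_ ts] [st]].
move=> /(belowF _ _ (@subset_refl _ _)) yF.
case: y ny yF => [F'|C|] ny yF.
- congr KPoint; apply/val_inj/seteqP; split=> s Fs.
    by have [t Ft [<-]] := yF (kpoint s) (ex_intro2 _ _ s Fs erefl).
  apply: contrapT => nFs; apply: ny; exists s => //.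
  apply/(belowF _ _ (@subDsetl _ _ _)).
  move=> _ [t Ft <-]; exists t => //; split.
    by have [t' Ft' [<-]] := yF (kpoint t) (ex_intro2 _ _ t Ft erefl).
  by move=> ts; apply: nFs; rewrite -ts.
- by have [] := yF (klimit (unstar C)) (or_introl erefl).
- by have [] := yF kinfty I.
Qed.

(** The sets [gbelow W] with [W] small, pulled back along [gstar], generate
the clopen sets [ksel y] of K_(A-star), hence its topology. *)
Lemma continuous_kstar (X : topologicalType) (f : X -> kspace (star A)) :
  (forall W, small W -> clopen ((gstar \o f) @^-1` gbelow W)) -> continuous f.
Proof.
move=> cf; apply: continuous_kspace.
case=> [F|C|]; last exact: clopenT.
- rewrite (ksel_kpoint_gbelow F) setDE preimage_setI -preimage_setC preimage_bigcup.
  have finF : finite_set (val F) := (set_mem (valP F)).1.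
  have cD D : D `<=` val F -> clopen ((gstar \o f) @^-1` gbelow (kpoint @` D)).
    by move=> DF; apply: cf; left; exists D => //; exact: sub_finite_set finF.
  apply: clopenI; first exact: cD.
  apply: (clopenC set0).
  by apply: clopen_bigcup => // s _; apply: cD => t [].
- by rewrite (ksel_klimit_gbelow C); apply: cf; right; exists (unstar C).
Qed.

End GSpaceProperties.

(** * The topology of G and the embedding of K_A *)

Unset Implicit Arguments.

Theorem theorem4p12 (S : Type) (A : set (set S))
    (adA : almost_disjoint A) (infA : infinite_set A)
    (covA : \bigcup_(B in A) B = [set: S]) :
  exists (phi : kspace (star A) -> gspace A) (psi : gspace A -> kspace (star A)),
    ([/\ forall F : fin_subsets S, phi (kpoint F) = gclass (hfin F),
         forall B : A, phi (klimit (star_mem B)) = gclass (hdown adA (klimit B)) &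
         phi kinfty = ginfty] /\
     [/\ cancel phi psi, cancel psi phi, continuous phi & continuous psi] /\
     is_mrowka_space (gspace A) /\
     (partial_order (@gle S A) /\
      exists j : gspace A -> gspace A -> gspace A,
        [/\ forall L M, j (gclass L) (gclass M) = gclass (hyper_join L M),
            is_join gle j &
            continuous (fun p : gspace A * gspace A => j p.1 p.2)]) /\
     (exists U : gspace A -> set (gspace A), canonical_clopen_selector U)) /\
    let eta (x : kspace A) : kspace (star A) := psi (gclass (hdown adA x)) in
    [/\ injective eta,
        {homo eta : x y / kle x y >-> kle x y},
        {homo eta : x y / kle x y >-> gle (phi x) (phi y)} &
        continuous eta].
Proof.
have adA' := almost_disjoint_star adA; have infA' := infinite_star infA.
have [psi [phiK psiK]] := gstar_bij adA; pose phi := gstar adA.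
have cpsi : continuous psi.
  apply: (continuous_kstar (adA := adA)) => W sW.
  rewrite (_ : _ \o _ = id); last by apply/funext => g; exact: psiK.
  exact: clopen_gbelow.
have cphi : continuous phi.
  exact: continuous_inverse gspace_compact (kspace_hausdorff adA') cpsi psiK phiK.
exists phi, psi; split; last first.
  move=> eta; have etaK x : phi (eta x) = gclass (hdown adA x) by exact: psiK.
  have homo_gle : {homo eta : x y / kle x y >-> gle (phi x) (phi y)}.
    by move=> x y xy; rewrite !etaK; apply/gle_gclass; left.
  split=> //.
  - move=> x y exy; have /gclass_eq[hxy|[/hdown_hE-> /hdown_hE->]//] :
        gclass (hdown adA x) = gclass (hdown adA y) by rewrite -!etaK exy.
    have kxy : ksel x = ksel y by by rewrite -[LHS]/(hset (hdown adA x)) hxy.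
    by apply: kle_anti; [rewrite kxy|rewrite -kxy]; exact: kpoint_in_ksel.
  - move=> x [s|B|] xy.
    + by rewrite (_ : x = kpoint s); [|apply: xy; exact: kpoint_in_ksel].
    + have -> : eta (klimit B) = klimit (star_mem B).
        by apply: (can_inj phiK); rewrite -/phi etaK /phi /gstar /= star_memK.
      apply: ksel_kle; rewrite (ksel_klimit_gbelow adA (star_mem B)).
      rewrite /preimage /= -/phi etaK star_memK.
      by exists (hdown adA x).
    + have -> : eta kinfty = kinfty; last by [].
      apply: (can_inj phiK); rewrite -/phi etaK.
      by congr gclass; exact: hyper_inj.
  - apply: (continuous_kstar (adA := adA)) => W sW.
    rewrite (_ : _ @^-1` _ = W); first exact: small_clopen.
    apply/seteqP; split=> x; rewrite /preimage /= -/phi etaK gbelow_gclass //.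
      by apply; exact: kpoint_in_ksel.
    by move=> Wx y /ksel_kle yx; exact: small_initial yx Wx.
split; first by split=> // B; rewrite /phi /gstar /= star_memK.
split=> //.
split; first exact: mrowka_homeo psiK phiK cpsi cphi (kspace_mrowka adA' infA').
split; last first.
  exists (fun g => psi @^-1` ksel (psi g)); split.
    have := clopen_selector_homeo psiK cpsi (clopen_selector_ksel adA'); exact.
  move=> g; have [n nE] := iter_cb_derived_ksel adA' infA' (psi g).
  apply: (@last_cb_derivative_iter _ n).
  rewrite (iter_cb_derived_homeo psiK phiK cpsi cphi) nE (preimage_set1_can psiK phiK).
  by congr [set _]; exact: psiK.
split; first exact: gle_partial_order.
exists (@gjoin S A); split; [exact: gjoin_gclass|exact: gjoin_is_join|].
(* [phi] is continuous, so the join may be tested after applying [psi], where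
   the criterion [continuous_kstar] is available. *)
set J := (X in continuous X).
have -> : J = phi \o (psi \o J) by apply/funext => p; exact/esym/psiK.
move=> p; apply: continuous_comp; last exact: cphi.
move: p; apply: (continuous_kstar (adA := adA)) => W sW.
rewrite (_ : _ @^-1` _ = fst @^-1` gbelow W `&` snd @^-1` gbelow W); last first.
  by apply/seteqP; split=> p; rewrite /preimage /= psiK gbelow_gjoin.
apply: clopenI; apply: preimage_clopen (clopen_gbelow adA sW) _.
- by move=> p; exact: cvg_fst.
- by move=> p; exact: cvg_snd.
Qed.
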